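(* Let $\mathcal{Z}$ and $\mathcal{Z}'$ be two global cross sections for the action of $\mathcal{G}$ on $\mathcal{X}$ with the same common isotropy subgroup $\mathcal{G}_0$, and let $w:\mathcal{X}\to\mathcal{X}$ be the within-orbit bijection $w(x)=g(x)z'(x)$ (notation as in the context). Suppose that $x$ is distributed according to a cross-sectionally contoured distribution $f_{\mathcal{Y}}(y(x))\lambda(dx)$ with respect to $\mathcal{Z}$. Then the distribution of $w=w(x)$ is \[ f_{\mathcal{Y}}(y'(w))\,\chi(g(w)^{-1}g'(w))\,\Delta^{\mathcal{G}}(g(w)^{-1}g'(w))\,\lambda(dw), \] where $\Delta^{\mathcal{G}}$ is the right-hand modulus of $\mathcal{G}$: $\mu_{\mathcal{G}}(d(gg_1))=\Delta^{\mathcal{G}}(g_1)\mu_{\mathcal{G}}(dg)$, $g_1\in\mathcal{G}$.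
   Context: A group $\mathcal{G}$ acts on a space $\mathcal{X}$ from the left. The isotropy subgroup at $x$ is $\mathcal{G}_x=\{g\in\mathcal{G}: gx=x\}$. A cross section is a subset of $\mathcal{X}$ meeting each orbit $\mathcal{G}x$ in exactly one point; it is a global cross section if the isotropy subgroup is the same at all of its points. Let $\mathcal{Z}$, $\mathcal{Z}'$ be global cross sections with $\mathcal{G}_z=\mathcal{G}_{z'}=\mathcal{G}_0$ for all $z\in\mathcal{Z}$, $z'\in\mathcal{Z}'$. Put $\mathcal{Y}=\mathcal{G}/\mathcal{G}_0$ (left cosets), $\pi:\mathcal{G}\to\mathcal{Y}$, $\pi(g)=g\mathcal{G}_0$. The orbital decomposition with respect to $\mathcal{Z}$ is the bijection $\mathcal{X}\leftrightarrow\mathcal{Y}\times\mathcal{Z}$, $x\leftrightarrow(y(x),z(x))$, where $x=gz(x)$ and $y(x)=\pi(g)$; similarly $x\leftrightarrow(y'(x),z'(x))\in\mathcal{Y}\times\mathcal{Z}'$ is the orbital decomposition with respect to $\mathcal{Z}'$. Let $g(x)\in\mathcal{G}$ denote an arbitrary selection of an element of the coset $y(x)$ (through a selection $\mathcal{Y}\to\mathcal{G}$), so $x=g(x)z(x)$; likewise $g'(x)\in y'(x)$, so $x=g'(x)z'(x)$. The map $w(x)=g(x)z'(x)$ does not depend on the choice of selection. Standing assumptions (measurability means Borel measurability; quotient spaces carry the quotient topology): (1) $\mathcal{X}$ is a locally compact Hausdorff space; (2) $\mathcal{G}$ is a second countable, locally compact Hausdorff topological group acting continuously on $\mathcal{X}$;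 (3) $\mathcal{G}_0$ is compact; (4) the global cross sections considered are locally compact in the relative topology, and the corresponding orbital decompositions are bimeasurable. $\lambda$ is a measure on $\mathcal{X}$ that is relatively invariant with multiplier $\chi$: $\lambda(d(gx))=\chi(g)\lambda(dx)$, $g\in\mathcal{G}$, where $\chi$ is a continuous homomorphism from $\mathcal{G}$ to the multiplicative group of positive reals. $\mu_{\mathcal{G}}$ is a left Haar measure on $\mathcal{G}$, $\mu_{\mathcal{Y}}=\mu_{\mathcal{G}}\pi^{-1}$, and $\chi(y):=\chi(g)$ for any $g\in\pi^{-1}(\{y\})$. The measure $\lambda$ factors as $\lambda(dx)=\chi(y)\mu_{\mathcal{Y}}(dy)\nu_{\mathcal{Z}}(dz)$, with $\nu_{\mathcal{Z}}$ standardized to be a probability measure on $\mathcal{Z}$. A distribution (probability measure) on $\mathcal{X}$ is cross-sectionally contoured with respect to $\mathcal{Z}$ if it is of the form $f_{\mathcal{Y}}(y(x))\lambda(dx)$ for some function $f_{\mathcal{Y}}$ on $\mathcal{Y}$. *)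

(* Defs.v *)
From HB Require Import structures.
From mathcomp Require Import all_boot all_order all_algebra.
From mathcomp Require Import generic_quotient.
From mathcomp Require Import all_classical all_reals all_analysis.

Set Implicit Arguments.
Unset Strict Implicit.
Unset Printing Implicit Defensive.

Import Order.TTheory GRing.Theory Num.Theory.
Import numFieldNormedType.Exports.

Local Open Scope classical_set_scope.
Local Open Scope quotient_scope.
Local Open Scope ring_scope.

Notation borel T := (g_sigma_algebraType (@open T)).

HB.mixin Record isTopologicalGroup G & Group G & Topological G := {
  mulg_continuous : continuous (fun p : G * G => (p.1 * p.2)%g) ;
  invg_continuous : continuous (fun g : G => (g^-1)%g)
}.

(* The base point is only there because [measurableType] is pointed; it is
   not required to be the unit. *)
#[short(type="topologicalGroupType")]
HB.structure Definition TopologicalGroup :=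
  {G of Group G & PointedTopological G & isTopologicalGroup G}.

Section LeftCosets.
Variables (G : topologicalGroupType) (H : set G).

Definition left_coset (g : G) : set G := [set (g * h)%g | h in H].

(* Stated with equality of cosets rather than with [g^-1 * g' \in H], so that
   this is an equivalence relation even when [H] is not known to be a
   subgroup. *)
Definition same_left_coset : rel G :=
  fun g g' => `[< left_coset g = left_coset g' >].

Fact same_left_coset_equiv : equiv_class_of same_left_coset.
Proof.
split=> [g|g g'|g' g g'']; first exact/asboolP.
  by apply/asboolP/asboolP.
by move=> /asboolP h1 /asboolP h2; apply/asboolP; rewrite h1.
Qed.

Canonical same_left_coset_equiv_rel := EquivRelPack same_left_coset_equiv.

Definition left_cosets := quotient_topology {eq_quot same_left_coset}.

HB.instance Definition _ := PointedTopological.on left_cosets.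
HB.instance Definition _ := Quotient.on left_cosets.

Definition coset_proj (g : G) : left_cosets := \pi_left_cosets g.

End LeftCosets.

Record left_action (G : groupType) (X : Type) := LeftAction {
  act :> G -> X -> X ;
  act1 : forall x, act 1%g x = x ;
  actM : forall g h x, act (g * h)%g x = act g (act h x)
}.

Section CrossSections.
Variables (G : groupType) (X : Type) (a : left_action G X).

Definition act_orbit (x : X) : set X := [set a g x | g in [set: G]].

Definition isotropy (x : X) : set G := [set g | a g x = x].

Definition cross_section (Z : set X) :=
  forall x, exists z, Z `&` act_orbit x = [set z].

Record global_cross_section := GlobalCrossSection {
  gcs_set :> set X ;
  gcs_cross_section : cross_section gcs_set ;
  gcs_isotropy :
    forall z z', gcs_set z -> gcs_set z' -> isotropy z = isotropy z'
}.

End CrossSections.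

Section CrossSectionSpace.
Variables (G : groupType) (X : ptopologicalType) (a : left_action G X).
Variable Z : global_cross_section a.

Definition gcs_space := set_type Z.

HB.instance Definition _ := Topological.on gcs_space.

Fact gcs_nonempty : exists z, z \in gcs_set Z.
Proof.
have [z Zz] := gcs_cross_section Z point; exists z; apply/mem_set.
by have [] : (Z `&` act_orbit a point) z by rewrite Zz.
Qed.

HB.instance Definition _ := isPointed.Build gcs_space
  (exist _ (projT1 (cid gcs_nonempty)) (projT2 (cid gcs_nonempty))).

Definition gcs_val (z : gcs_space) : X := set_val z.

End CrossSectionSpace.

Definition bimeasurable d d' (S : measurableType d) (T : measurableType d')
    (f : S -> T) :=
  measurable_fun [set: S] f /\
  exists h : T -> S, [/\ cancel f h, cancel h f & measurable_fun [set: T] h].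

Section OrbitalDecomposition.
Variables (G : topologicalGroupType) (X : ptopologicalType).
Variables (a : left_action G X) (G0 : set G) (Z : global_cross_section a).
Implicit Types (y : X -> left_cosets G0) (z : X -> gcs_space Z).

Definition orbital_decomposition y z :=
  forall x, exists2 g, x = a g (gcs_val (z x)) & y x = coset_proj G0 g.

Definition bimeasurable_decomposition y z :=
  bimeasurable ((fun x => (y x, z x)) :
    borel X -> borel (left_cosets G0 * gcs_space Z)%type).

End OrbitalDecomposition.

Section HaarMeasure.
Variables (R : realType) (G : topologicalGroupType).
Variable mu : {measure set (borel G) -> \bar R}.
Local Open Scope ereal_scope.

Definition radon :=
  [/\ forall K : set G, compact K -> mu K < +oo,
      forall B : set (borel G), measurable B ->
        mu B = ereal_inf [set mu U | U in [set U : set G | open U /\ B `<=` U]]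
    & forall U : set G, open U ->
        mu U =
        ereal_sup [set mu K | K in [set K : set G | compact K /\ K `<=` U]]].

Definition left_haar_measure :=
  [/\ radon, mu [set: G] != 0
    & forall (g : G) (B : set (borel G)), measurable B ->
        mu [set (g * h)%g | h in B] = mu B].

Definition right_modulus (Delta : G -> R) :=
  forall (g1 : G) (B : set (borel G)), measurable B ->
    mu [set (g * g1)%g | g in B] = (Delta g1)%:E * mu B.

End HaarMeasure.

Definition multiplier (R : realType) (G : topologicalGroupType)
    (chi : G -> R) :=
  [/\ forall g, 0 < chi g, forall g h, chi (g * h)%g = chi g * chi h
    & continuous chi].

Section Densities.
Variables (R : realType) (G : topologicalGroupType) (X : ptopologicalType).
Variables (a : left_action G X) (lambda : {measure set (borel X) -> \bar R}).
Local Open Scope ereal_scope.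

Definition relatively_invariant (chi : G -> R) :=
  forall (g : G) (B : set (borel X)), measurable B ->
    lambda (a g @` B) = (chi g)%:E * lambda B.

Definition has_density (D : set (borel X) -> \bar R) (p : X -> R) :=
  [/\ measurable_fun [set: borel X] (p : borel X -> R),
      forall x, (0 <= p x)%R
    & forall B : set (borel X), measurable B ->
        D B = \int[lambda]_(x in B) (p x)%:E].

Variables (G0 : set G) (Z : global_cross_section a).
Implicit Types (y : X -> left_cosets G0) (z : X -> gcs_space Z).

(* A continuous homomorphism into the positive reals is trivial on a compact
   subgroup [G0], so the choice of representative is immaterial. *)
Definition coset_multiplier (chi : G -> R) (yy : left_cosets G0) : R :=
  chi (repr yy).

Definition coset_measure (mu : set (borel G) -> \bar R) :
    set (borel (left_cosets G0)) -> \bar R :=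
  pushforward mu
    (coset_proj G0 : borel G -> borel (left_cosets G0)).

(* lambda(dx) = chi(y) mu_Y(dy) nu_Z(dz); the product measure lives on the
   product of the Borel sigma-algebras, which is the Borel sigma-algebra of
   the product space as soon as [G], hence [left_cosets G0], is second
   countable. *)
Definition factors (chi : G -> R) (mu : {measure set (borel G) -> \bar R})
    (nu : probability (borel (gcs_space Z)) R) y z :=
  forall B : set (borel X), measurable B ->
    lambda B =
    \int[coset_measure mu \x nu]_(p in (fun x => (y x, z x)) @` B)
      (coset_multiplier chi p.1)%:E.

Definition cross_sectionally_contoured (f : left_cosets G0 -> R) y
    (D : set (borel X) -> \bar R) :=
  has_density D (f \o y).

End Densities.

Section WithinOrbit.
Variables (G : topologicalGroupType) (X : ptopologicalType).
Variables (a : left_action G X) (G0 : set G) (Z' : global_cross_section a).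

Definition selection (s : left_cosets G0 -> G) := cancel s (coset_proj G0).

Definition within_orbit (g : X -> G) (z' : X -> gcs_space Z') (x : X) : X :=
  a (g x) (gcs_val (z' x)).

End WithinOrbit.

(* Main.v *)
Require Import Defs.
From HB Require Import structures.
From mathcomp Require Import all_boot all_order all_algebra.
From mathcomp Require Import generic_quotient.
From mathcomp Require Import all_classical all_reals all_analysis.
From mathcomp Require Import measurable_realfun.

Set Implicit Arguments.
Unset Strict Implicit.
Unset Printing Implicit Defensive.

Import Order.TTheory GRing.Theory Num.Theory.
Import numFieldNormedType.Exports.

Local Open Scope classical_set_scope.
Local Open Scope ring_scope.

(* In the coordinates [x = g u] ([g] in [G], [u] in [Z]) the measure [lambda] is
   [chi(g) mu(dg) nu(du)].  Write a point [u] of [Z] as [u = n(u) v] with [v] in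
   [Z']; then [n(u)] normalizes [G0], and [w] maps [g u] to [g v = g n(u)^-1 u].
   So on each slice [w] is the right translation by [n(u)^-1], which contributes
   [chi(n(u)) Delta(n(u))], and [n(u)] is [g(x)^-1 g'(x)] modulo [G0], where
   both [chi] and [Delta] are trivial.  As [y' (w x) = y x], the density
   [f (y x)] becomes [f (y' w)]. *)

(** The selections [s] and [s'] are arbitrary and may fail to be measurable, and [Delta] is known
    only through [right_modulus], so measurability of [w] and of the density is a real part of the
    work. Both are rewritten through the maps [y], [y'] and [z'], from which the selections have
    disappeared, and [Delta] is shown to be measurable on cosets. The integrals are lifted from G/G0
    to G because the translation by n(u)^-1 is then covered by [right_modulus] directly. A further
    obstacle is that a Borel set of a product need not be product measurable; second countability of
    G/G0 closes this gap, as Z carries no countability assumption. *)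

(** * Borel sets and integrals *)

(* Joins the existing pointed and topological structures of a product into a
   [ptopologicalType]. *)
HB.instance Definition _ (S T : ptopologicalType) := Pointed.on (S * T)%type.

Lemma measurable_open (T : ptopologicalType) (U : set T) :
  open U -> measurable (U : set (borel T)).
Proof. exact: sub_sigma_algebra. Qed.

Lemma measurable_closed (T : ptopologicalType) (C : set T) :
  closed C -> measurable (C : set (borel T)).
Proof.
move=> cC; rewrite -(setCK C); apply: measurableC.
by apply: measurable_open; exact/closed_openC.
Qed.

Lemma continuous_measurable_borel (S T : ptopologicalType) (f : S -> T) :
  continuous f -> measurable_fun setT (f : borel S -> borel T).
Proof.
move=> /continuousP cf; apply: (@measurability _ _ (borel S) (borel T) _ _
  (@open T) erefl) => _ [U oU <-].
by rewrite setTI; apply: measurable_open; exact: cf.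
Qed.

Lemma countable_bigcup_measurable d (T : measurableType d) (I : Type)
    (D : set I) (F : I -> set T) :
  countable D -> (forall i, D i -> measurable (F i)) ->
  measurable (\bigcup_(i in D) F i).
Proof.
move=> /pfcard_geP[->|[f]] mF; first by rewrite bigcup_set0.
rewrite -(image_eq f) bigcup_image; apply: bigcup_measurable => k _.
by apply: mF; exact: funS.
Qed.

(** For each basic open b of [S], all open W with b * W inside [U] are merged into one open set
    [V b]. Only the union over b must then be countable, so a countable base of one factor is
    enough. *)
Lemma open_measurable_prod (S T : ptopologicalType) (U : set (S * T)) :
  @second_countable S -> open U ->
  measurable (U : set (borel S * borel T)%type).
Proof.
move=> [B cB [oB nB]] oU.
pose V b := \bigcup_(W in [set W : set T | open W /\ b `*` W `<=` U]) W.
have -> : U = \bigcup_(b in B) (b `*` V b).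
  apply/seteqP; split=> [[x1 x2] Ux|[x1 x2] [b Bb [/= bx [W [oW bWU] Wx]]]].
    have [[P Q] /= [nP nQ] PQU] : nbhs (x1, x2) U by apply: open_nbhs_nbhs.
    have [b [Bb bx] bP] := nB x1 P nP.
    exists b => //; split => //=.
    have := nQ; rewrite nbhsE => -[W [oW Wx] WQ].
    by exists W => //; split => // -[u1 u2] [/= bu Wu]; apply: PQU; split;
      [exact: bP | exact: WQ].
  exact: bWU.
apply: countable_bigcup_measurable => // b Bb.
apply: measurableX; first by apply: measurable_open; exact: oB.
by apply: measurable_open; apply: bigcup_open => W [].
Qed.

Lemma closed_measurable_prod (S T : ptopologicalType) (C : set (S * T)) :
  @second_countable S -> closed C ->
  measurable (C : set (borel S * borel T)%type).
Proof.
move=> scS cC; rewrite -(setCK C); apply: measurableC.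
by apply: open_measurable_prod => //; rewrite openC.
Qed.

(** Bridges [bimeasurable_decomposition], stated for the Borel sets of the product space, and the
    product measure, which lives on the product of the Borel sigma-algebras. *)
Lemma measurable_prod_borel (S T : ptopologicalType) :
  @second_countable S ->
  measurable_fun setT (idfun : borel S * borel T -> borel (S * T)%type).
Proof.
move=> scS; apply: (@measurability _ _ (borel S * borel T)%type
  (borel (S * T)%type) _ _ (@open (S * T)%type) erefl) => _ [U oU <-].
by rewrite setTI; exact: open_measurable_prod.
Qed.

(** For nonnegative values the inverse is the power of exponent -1, which is measurable; at 0 both
    take the value 0. *)
Lemma measurable_funV d (T : measurableType d) (R : realType) (f : T -> R) :
  (forall t, 0 <= f t) -> measurable_fun setT f ->
  measurable_fun setT (fun t => (f t)^-1).
Proof.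
move=> f0 mf; rewrite (_ : (fun t => _) = (fun t => f t `^ (-1))).
  exact: (@measurableT_comp _ _ _ _ _ _ (fun u : R => u `^ (-1)) _ f).
by apply/funext => t; rewrite powR_inv1.
Qed.

Section SigmaFiniteMeasureOf.
Context d (T : measurableType d) (R : realType).

(* The proof is an argument of the definition so that the canonical structure
   declared below can depend on it. *)
Definition sigma_finite_measure_of (m : {measure set T -> \bar R})
  (sfm : sigma_finite [set: T] m) : set T -> \bar R := m.

Variables (m : {measure set T -> \bar R}) (sfm : sigma_finite [set: T] m).

HB.instance Definition _ := Measure.on (sigma_finite_measure_of sfm).
HB.instance Definition _ := @Measure_isSigmaFinite.Build _ _ _
  (sigma_finite_measure_of sfm) sfm.

End SigmaFiniteMeasureOf.

Section DensityIntegral.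
Local Open Scope ereal_scope.
Context d (T : measurableType d) (R : realType).
Variables (m n : {measure set T -> \bar R}) (p : T -> R).
Hypotheses (mp : measurable_fun setT p) (p0 : forall t, (0 <= p t)%R).
Hypothesis n_density :
  forall B, measurable B -> n B = \int[m]_(t in B) (p t)%:E.

Import HBNNSimple.

(** Monotone convergence along simple approximations of [F], then linearity, reduce the identity to
    indicators, where it is [n_density]. *)
Lemma ge0_integral_density (F : T -> \bar R) :
  measurable_fun setT F -> (forall t, 0 <= F t) ->
  \int[n]_t F t = \int[m]_t (F t * (p t)%:E).
Proof.
move=> mF F0; pose h := nnsfun_approx measurableT mF.
have mpE : measurable_fun setT (EFin \o p) by exact/measurable_EFinP.
transitivity (limn (fun k => \int[n]_t (h k t)%:E)).
  rewrite -monotone_convergence//.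
  - apply: eq_integral => t _; apply/esym/cvg_lim => //.
    exact: cvg_nnsfun_approx.
  - by move=> k; exact/measurable_EFinP.
  - by move=> k t _; rewrite lee_fin.
  - by move=> t _ a b ab; rewrite lee_fin; exact/lefP/nd_nnsfun_approx.
transitivity (limn (fun k => \int[m]_t ((h k t)%:E * (p t)%:E))); last first.
  rewrite -monotone_convergence//.
  - apply: eq_integral => t _; apply/cvg_lim => //.
    by apply: cvgeZr => //; exact: cvg_nnsfun_approx.
  - by move=> k; apply: emeasurable_funM => //; exact/measurable_EFinP.
  - by move=> k t _; rewrite mule_ge0 ?lee_fin.
  - move=> t _ a b ab; rewrite lee_wpmul2r ?lee_fin//.
    exact/lefP/nd_nnsfun_approx.
congr (limn _); apply/funext => k.
have mind r : measurable_fun setT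
    (fun t => (r * \1_(h k @^-1` [set r]) t)%:E).
  by apply/measurable_EFinP; exact: measurable_funM.
under eq_integral do rewrite fimfunE -fsumEFin//.
rewrite ge0_integral_fsum//; last by move=> r t _; exact: nnfun_muleindic_ge0.
under [RHS]eq_integral => t _.
  rewrite fimfunE -fsumEFin// ge0_mule_fsuml => [|r]; last first.
    exact: nnfun_muleindic_ge0.
  over.
rewrite ge0_integral_fsum//; last 2 first.
- by move=> r; apply: emeasurable_funM.
- move=> r t _; rewrite mule_ge0 ?lee_fin// -lee_fin EFinM.
  exact: nnfun_muleindic_ge0.
apply: eq_fsbigr => r rh.
have r0 : (0 <= r)%R by move: rh; rewrite inE => -[t _ <-].
have mA : measurable (h k @^-1` [set r]) by [].
under eq_integral do rewrite EFinM.
under [RHS]eq_integral do rewrite EFinM -muleA.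
have mAE : measurable_fun setT (fun t => (\1_(h k @^-1` [set r]) t : R)%:E).
  exact/measurable_EFinP.
rewrite ge0_integralZl_EFin// ge0_integralZl_EFin//; last 2 first.
- by move=> t _; rewrite mule_ge0 ?lee_fin.
- exact: emeasurable_funM.
rewrite integral_indic// setIT n_density//; congr (_ * _).
rewrite integral_mkcond; apply: eq_integral => t _.
by rewrite epatch_indic muleC.
Qed.

End DensityIntegral.

(** * Coset spaces of topological groups *)

Section LeftCosetSpace.
Variables (G : topologicalGroupType) (H : set G).
Hypotheses (H1 : H 1%g) (HM : forall g h, H g -> H h -> H (g * h)%g)
  (HV : forall g, H g -> H (g^-1)%g).

Lemma coset_proj_eq (g h : G) :
  (coset_proj H g = coset_proj H h) <-> H (g^-1 * h)%g.
Proof.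
split.
  move=> /eqquotP /asboolP gh.
  have : left_coset H h h by exists 1%g => //; rewrite mulg1.
  by rewrite -gh => -[k Hk <-]; rewrite mulKg.
move=> Hgh; apply/eqquotP/asboolP; apply/seteqP; split=> _ [k Hk <-].
  exists ((g^-1 * h)^-1 * k)%g; first by apply: HM => //; exact: HV.
  by rewrite invgM invgK !mulgA mulgV mul1g.
exists (g^-1 * h * k)%g; first exact: HM.
by rewrite !mulgA mulgV mul1g.
Qed.

End LeftCosetSpace.

Section TopologicalGroupTheory.
Variable G : topologicalGroupType.

Lemma mulgr_continuous (g : G) : continuous (fun h : G => (h * g)%g).
Proof.
move=> h; apply: (@continuous2_cvg _ _ _ _ _ _ id (fun _ => g)
  (fun a b : G => (a * b)%g)).
- exact: (@mulg_continuous G (h, g)).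
- exact: cvg_id.
- exact: cvg_cst.
Qed.

Lemma compact_mulg (A B : set G) : compact A -> compact B ->
  compact [set (a * b)%g | a in A & b in B].
Proof.
move=> cA cB.
have -> : [set (a * b)%g | a in A & b in B] =
    (fun p : G * G => (p.1 * p.2)%g) @` (A `*` B).
  apply/seteqP; split=> [_ [u Au [v Bv <-]]|_ [[u v] [/= Au Bv] <-]].
    by exists (u, v).
  by exists u => //; exists v.
apply: continuous_compact; last exact: compact_setX.
by apply: continuous_subspaceT; exact: mulg_continuous.
Qed.

(** The basic open sets contained in some compact set are countably many, and by local compactness
    they cover [G]. *)
Lemma sigma_compact : @second_countable G -> locally_compact [set: G] ->
  exists2 K : nat -> set G, \bigcup_n K n = setT & forall n, compact (K n).
Proof.
move=> [B cB [oB nB]] lcG.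
pose D := [set b | B b /\ exists2 K, compact K & b `<=` K].
have coverD x : exists2 b, D b & b x.
  have [K Kx [cK _]] := lcG x I; rewrite withinET in Kx.
  have [b [Bb bx] bK] := nB x K Kx.
  by exists b => //; split => //; exists K.
have cD : countable D by apply: sub_countable cB; apply: subset_card_le => b [].
move: cD => /pfcard_geP[D0|[f]].
  by have [b] := coverD point; rewrite D0.
have Df n : D (f n) by exact: funS.
exists (fun n => projT1 (cid2 (Df n).2)); last by move=> n; case: cid2.
apply/seteqP; split=> // x _; have [b Db bx] := coverD x.
have [n _ fn] : (f @` setT) b by rewrite image_eq.
by exists n => //; case: cid2 => K _ /=; apply; rewrite fn.
Qed.

End TopologicalGroupTheory.

Section LeftCosetTopology.
Variables (G : topologicalGroupType) (H : set G).
Hypotheses (H1 : H 1%g) (HM : forall g h, H g -> H h -> H (g * h)%g)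
  (HV : forall g, H g -> H (g^-1)%g).

Lemma coset_proj_continuous : continuous (coset_proj H).
Proof. exact: pi_continuous. Qed.

Lemma coset_proj_surj (c : left_cosets H) : exists g, coset_proj H g = c.
Proof. by exists (repr c); exact: reprK. Qed.

Lemma coset_proj_preimage_image (A : set G) :
  coset_proj H @^-1` (coset_proj H @` A) = [set (g * h)%g | g in A & h in H].
Proof.
apply/seteqP; split=> [g [k Ak]|_ [g Ag [h Hh <-]]].
  move=> /(coset_proj_eq H1 HM HV) Hkg.
  by exists k => //; exists (k^-1 * g)%g => //; rewrite mulVKg.
by exists g => //; apply/(coset_proj_eq H1 HM HV); rewrite mulKg.
Qed.

(** The quotient topology asks for openness of the saturation U H, which is a union of right
    translates of [U]. *)
Lemma coset_proj_open (U : set G) : open U -> open (coset_proj H @` U).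
Proof.
move=> oU; suff : open (coset_proj H @^-1` (coset_proj H @` U)) by [].
rewrite coset_proj_preimage_image.
have -> : [set (g * h)%g | g in U & h in H] =
    \bigcup_(h in H) ((fun g => (g * h^-1)%g) @^-1` U).
  apply/seteqP; split=> [_ [g Ug [h Hh <-]]|g [h Hh Ugh]].
    by exists h => //=; rewrite mulgK.
  by exists (g * h^-1)%g => //; exists h => //; rewrite mulgVK.
apply: bigcup_open => h _.
by move/continuousP: (@mulgr_continuous G h^-1%g); exact.
Qed.

Lemma second_countable_cosets :
  @second_countable G -> @second_countable (left_cosets H).
Proof.
move=> [B cB [oB nB]]; exists ((fun b => coset_proj H @` b) @` B).
  by apply: sub_countable cB; exact: card_image_le.
split=> [_ [b Bb <-]|c A]; first by apply: coset_proj_open; exact: oB.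
have [g <-] := coset_proj_surj c => /coset_proj_continuous nA.
have [b [Bb bg] bA] := nB g _ nA.
exists (coset_proj H @` b); last by move=> _ [k /bA ? <-].
by split; [exists b | exists g].
Qed.

End LeftCosetTopology.

(** * The modular function *)

Section ModularFunction.
Local Open Scope ereal_scope.
Variables (R : realType) (G : topologicalGroupType).
Hypotheses (hausG : hausdorff_space G) (scG : @second_countable G)
  (lcG : locally_compact [set: G]).
Variables (mu : {measure set (borel G) -> \bar R}) (Delta : G -> R).
Hypotheses (mu_haar : left_haar_measure mu)
  (Delta_mod : right_modulus mu Delta).

Lemma measurable_compact (K : set G) :
  compact K -> measurable (K : set (borel G)).
Proof. by move=> cK; apply: measurable_closed; exact: compact_closed. Qed.

Lemma haar_sigma_finite : sigma_finite [set: borel G] mu.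
Proof.
have [K KT cK] := sigma_compact scG lcG.
have [[mu_fin _ _] _ _] := mu_haar.
exists K => // n; split; last exact: mu_fin.
exact: measurable_compact.
Qed.

(** If every compact set were null, inner regularity on the open set [G] would make [mu] zero. Such
    a set is the test set on which identities for [Delta] are read off by cancelling its measure. *)
Lemma haar_compact_gt0 :
  exists K r, [/\ compact K, (0 < r)%R & mu K = r%:E].
Proof.
have [[mu_fin _ mu_in] mu_neq0 _] := mu_haar.
have [K cK muK] : exists2 K, compact K & mu K != 0.
  apply: contrapT => noK; move/eqP : mu_neq0; apply.
  apply/eqP; rewrite eq_le measure_ge0 andbT mu_in; last exact: openT.
  apply: ge_ereal_sup => _ [K [cK _] <-].
  have [->//|K0] := eqVneq (mu K) 0.
  by case: noK; exists K.
have muKfin : mu K \is a fin_num by rewrite ge0_fin_numE// mu_fin.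
exists K, (fine (mu K)); split => //; last by rewrite fineK.
by rewrite fine_gt0// mu_fin// lt0e muK measure_ge0.
Qed.

(** The preimage form of [right_modulus]: preimages compose and match the definition of a
    pushforward. *)
Lemma haar_mulgr (g : G) (B : set (borel G)) : measurable B ->
  mu ((fun h : G => (h * g^-1)%g) @^-1` B) = (Delta g)%:E * mu B.
Proof.
move=> mB; rewrite -Delta_mod//; congr (mu _).
apply/seteqP; split=> [h /= Bh|_ [h Bh <-] /=]; last by rewrite mulgK.
by exists (h * g^-1)%g => //; rewrite mulgVK.
Qed.

Lemma measurable_mulgr (g : G) (B : set (borel G)) : measurable B ->
  measurable ((fun h : G => (h * g)%g) @^-1` B : set (borel G)).
Proof.
move=> mB; rewrite -[X in measurable X]setTI.
exact: (continuous_measurable_borel (@mulgr_continuous G g)).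
Qed.

Lemma modulusM (g h : G) : Delta (g * h)%g = (Delta g * Delta h)%R.
Proof.
have [K [r [cK r0 muK]]] := haar_compact_gt0.
have mK := measurable_compact cK.
have := haar_mulgr (g * h)%g mK.
rewrite [X in mu X = _](_ : _ =
    (fun k : G => (k * h^-1)%g) @^-1` ((fun k : G => (k * g^-1)%g) @^-1` K)).
  rewrite haar_mulgr; last exact: measurable_mulgr.
  rewrite haar_mulgr// muK -!EFinM => -[] /eqP.
  by rewrite mulrA (inj_eq (mulIf (lt0r_neq0 r0))) mulrC => /eqP.
by apply/funext => k /=; rewrite invgM mulgA.
Qed.

(** A zero at [g] would force Delta 1 = 0 by multiplicativity, yet translation by 1 preserves a set
    of positive measure. *)
Lemma modulus_neq0 (g : G) : Delta g != 0%R.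
Proof.
have [K [r [cK r0 muK]]] := haar_compact_gt0.
apply/eqP => Dg; have := haar_mulgr 1%g (measurable_compact cK).
rewrite -(mulVg g) modulusM Dg mulr0 mul0e.
rewrite [X in mu X](_ : _ = K) ?muK => [[] /eqP|]; first by rewrite gt_eqF.
by apply/funext => k /=; rewrite mulVg invg1 mulg1.
Qed.

Lemma modulus1 : Delta 1%g = 1%R.
Proof.
by apply: (mulfI (modulus_neq0 1%g)); rewrite -modulusM mulg1 mulr1.
Qed.

Lemma modulus_gt0 (g : G) : (0 < Delta g)%R.
Proof.
have [K [r [cK r0 muK]]] := haar_compact_gt0.
rewrite lt0r modulus_neq0/=.
have := haar_mulgr g (measurable_compact cK); rewrite muK => Dr.
have : 0 <= (Delta g)%:E * r%:E by rewrite -Dr measure_ge0.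
by rewrite -EFinM lee_fin pmulr_lge0.
Qed.

Lemma ge0_integral_mulgr (h : G) (F : borel G -> \bar R) :
  measurable_fun setT F -> (forall g, 0 <= F g) ->
  \int[mu]_g F (g * h^-1)%g = (Delta h)%:E * \int[mu]_g F g.
Proof.
move=> mF F0.
have mh : measurable_fun setT
    ((fun g : G => (g * h^-1)%g) : borel G -> borel G).
  exact: continuous_measurable_borel (@mulgr_continuous G h^-1%g).
rewrite -(ge0_integral_mscale mu measurableT (NngNum (ltW (modulus_gt0 h))))//.
transitivity (\int[pushforward mu
  ((fun g : G => (g * h^-1)%g) : borel G -> borel G)]_g F g).
  by rewrite [RHS]ge0_integral_pushforward.
by apply: eq_measure_integral => A mA _; exact: haar_mulgr.
Qed.

Section CosetModulus.
Variable H : set G.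
Hypotheses (cH : compact H) (H1 : H 1%g)
  (HM : forall g h, H g -> H h -> H (g * h)%g)
  (HV : forall g, H g -> H (g^-1)%g).

(* Take [K H] for a compact [K] of positive measure. *)
Lemma haar_compact_invariant : exists KH t, [/\ compact KH,
  (forall k h, H h -> KH k -> KH (k * h)%g), (0 < t)%R & mu KH = t%:E].
Proof.
have [K [r [cK r0 muK]]] := haar_compact_gt0.
pose KH := [set (a * b)%g | a in K & b in H].
have cKH : compact KH by exact: compact_mulg.
have [[mu_fin _ _] _ _] := mu_haar.
have muKH0 : 0 < mu KH.
  apply: (@lt_le_trans _ _ (mu K)); first by rewrite muK lte_fin.
  apply: le_measure; rewrite ?inE; [exact: measurable_compact..|].
  by move=> k Kk; exists k => //; exists 1%g => //; rewrite mulg1.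
have muKHfin : mu KH \is a fin_num by rewrite ge0_fin_numE ?mu_fin// ltW.
exists KH, (fine (mu KH)); split => //; last by rewrite fineK.
  move=> k h Hh [a Ka [b Hb <-]]; exists a => //.
  by exists (b * h)%g; [exact: HM | rewrite mulgA].
by rewrite fine_gt0// muKH0 mu_fin.
Qed.

(** Right translation by [h] maps the [H]-invariant compact set [KH] onto itself, and its measure is
    positive and finite. *)
Lemma modulus_compact_subgroup h : H h -> Delta h = 1%R.
Proof.
move=> Hh; have [KH [t [cKH KHM t0 muKH]]] := haar_compact_invariant.
have := haar_mulgr h (measurable_compact cKH).
rewrite [X in mu X = _](_ : _ = KH).
  rewrite muKH -EFinM => -[] /eqP.
  by rewrite -[X in X == _]mul1r (inj_eq (mulIf (lt0r_neq0 t0))) => /eqP.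
apply/seteqP; split=> g /=; last by move/(KHM _ _ (HV Hh)).
by move=> /(KHM _ _ Hh); rewrite mulgVK.
Qed.

(** The image of a compact K has preimage K H, which is compact because [H] is: hence finite
    measure, and a closed image in the quotient topology. *)
Lemma coset_measure_sigma_finite :
  sigma_finite [set: borel (left_cosets H)] (coset_measure mu).
Proof.
have [K KT cK] := sigma_compact scG lcG.
have [[mu_fin _ _] _ _] := mu_haar.
exists (fun n => coset_proj H @` K n).
  rewrite -image_bigcup KT; apply/seteqP; split=> // c _.
  by have [g <-] := coset_proj_surj c; exists g.
move=> n; have cKH : compact [set (a * b)%g | a in K n & b in H].
  exact: compact_mulg.
split; last first.
  by rewrite /coset_measure /pushforward coset_proj_preimage_image// mu_fin.
apply: measurable_closed; rewrite -openC.
suff : open (~` (coset_proj H @^-1` (coset_proj H @` K n))) by [].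
by rewrite coset_proj_preimage_image// openC; exact: compact_closed.
Qed.

(* The measure of [K H g^-1] is proportional to [Delta g^-1], and as a function
   of [g] it factors through the cosets of [H]: it is the measure of a section
   of a closed subset of [left_cosets H * G]. *)
Lemma measurable_coset_modulus :
  measurable_fun setT (coset_multiplier Delta : borel (left_cosets H) -> R).
Proof.
have [KH [t [cKH KHM t0 muKH]]] := haar_compact_invariant.
pose E : set (borel (left_cosets H) * borel G)%type :=
  [set p | KH ((p.2 : G) * (repr p.1 : G))%g].
(* Right invariance of [KH] under [H] makes membership in [E] independent of the representative
   chosen by [repr]. *)
have EE g h : E (coset_proj H g, h) <-> KH (h * g)%g.
  have /(coset_proj_eq H1 HM HV) Hg : coset_proj H (repr (coset_proj H g)) =
      coset_proj H g by exact: reprK.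
  rewrite /E /=; split=> [/(KHM _ _ Hg)|/(KHM _ _ (HV Hg))].
    by rewrite mulgA mulgK.
  by rewrite invgM invgK !mulgA mulgK.
(* The complement of [E] pulls back to an open subset of G * G; a box around a point there projects
   to a neighbourhood because [coset_proj] is open. *)
have cE : closed (E : set (left_cosets H * G)%type).
  rewrite -openC openE => -[c h]; have [g <-] := coset_proj_surj c => nE.
  have ctm : continuous (fun p : G * G => (p.2 * p.1)%g).
    move=> [u v]; apply: (@continuous2_cvg _ _ _ _ _ _ (fun p : G * G => p.2)
      (fun p : G * G => p.1) (fun a b : G => (a * b)%g)).
    - exact: (@mulg_continuous G (v, u)).
    - exact: cvg_snd.
    - exact: cvg_fst.
  have : open ((fun p : G * G => (p.2 * p.1)%g) @^-1` (~` KH)).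
    by move/continuousP : ctm; apply; rewrite openC; exact: compact_closed.
  rewrite openE => /(_ (g, h)) [].
    by move=> /EE.
  move=> [U V] /= [nU nV] UV.
  exists (coset_proj H @` U, V) => /=.
    split=> //; move: nU; rewrite nbhsE => -[U' [oU' U'g] U'U].
    rewrite nbhsE; exists (coset_proj H @` U'); last exact: image_subset.
    by split; [exact: coset_proj_open | exists g].
  move=> [_ v] [/= [u Uu <-] Vv] /EE.
  exact: (UV (u, v)).
have scY := second_countable_cosets H1 HM HV scG.
have mE : measurable E by exact: (@closed_measurable_prod (left_cosets H) G).
have mx :=
  measurable_fun_xsection (sigma_finite_measure_of haar_sigma_finite) mE.
(* The section over c is KH (repr c)^-1, of measure t / Delta (repr c); solving for [Delta] gives
   the formula. *)
have -> : coset_multiplier Delta =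
    (fun c : left_cosets H => t / fine ((mu \o xsection E) c))%R.
  apply/funext => c /=.
  have -> : xsection E c = (fun h : G => (h * (repr c)^-1^-1)%g) @^-1` KH.
    by apply/seteqP; split=> h; rewrite /xsection /= inE /E /= invgK.
  rewrite haar_mulgr; last exact: measurable_compact.
  rewrite muKH -EFinM /=.
  have : Delta ((repr c)^-1 * repr c)%g = 1%R by rewrite mulVg modulus1.
  rewrite modulusM => D1; rewrite invfM mulrCA mulfV ?mulr1 ?gt_eqF//.
  apply: (mulfI (modulus_neq0 (repr c)^-1%g)).
  by rewrite D1 mulfV// modulus_neq0.
apply: measurable_funM => //; apply: measurable_funV.
  by move=> c; apply: fine_ge0.
exact: measurableT_comp.
Qed.

End CosetModulus.

End ModularFunction.

Section MultiplicativeOnCosets.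
Variables (R : realType) (G : topologicalGroupType) (H : set G) (D : G -> R).
Hypotheses (H1 : H 1%g) (HM : forall g h, H g -> H h -> H (g * h)%g)
  (HV : forall g, H g -> H (g^-1)%g).
Hypotheses (DM : forall g h, D (g * h)%g = D g * D h)
  (D1 : forall h, H h -> D h = 1).

Lemma coset_multiplierE g : coset_multiplier D (coset_proj H g) = D g.
Proof.
have /(coset_proj_eq H1 HM HV)/D1 : coset_proj H g =
    coset_proj H (repr (coset_proj H g)) by exact/esym/reprK.
rewrite /coset_multiplier => Dg.
by rewrite -[X in D X = _](mulVKg g) DM Dg mulr1.
Qed.

(** Removes the possibly non-measurable selections from the factors of the density: only the two
    cosets remain. It is applied to both [chi] and [Delta]. *)
Lemma coset_multiplier_ratio (s s' : left_cosets H -> G) :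
  (forall g, D g != 0) -> selection s -> selection s' ->
  forall c c', D ((s c)^-1 * s' c')%g =
    (coset_multiplier D c)^-1 * coset_multiplier D c'.
Proof.
move=> D0 s_sel s'_sel c c'; rewrite -{2}(s_sel c) -{2}(s'_sel c').
rewrite !coset_multiplierE; apply: (mulfI (D0 (s c))).
by rewrite mulrA divff// mul1r -DM mulVKg.
Qed.

End MultiplicativeOnCosets.

Section Multiplier.
Variables (R : realType) (G : topologicalGroupType) (chi : G -> R).
Hypothesis chi_mult : multiplier chi.

Lemma multiplier1 : chi 1%g = 1.
Proof.
have [chi_gt0 chiM _] := chi_mult.
by apply: (mulfI (lt0r_neq0 (chi_gt0 1%g))); rewrite -chiM mulg1 mulr1.
Qed.

Lemma multiplierV g : chi g^-1%g = (chi g)^-1.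
Proof.
have [chi_gt0 chiM _] := chi_mult.
apply: (mulfI (lt0r_neq0 (chi_gt0 g))).
by rewrite -chiM mulgV multiplier1 divff// lt0r_neq0.
Qed.

(** On the compact [H], [chi] attains a maximum at some m. Since m h lies in [H], chi m * chi h <=
    chi m, so chi h <= 1; the same bound for the inverse of h gives equality. *)
Lemma multiplier_compact_subgroup (H : set G) : compact H -> H 1%g ->
  (forall g h, H g -> H h -> H (g * h)%g) -> (forall g, H g -> H (g^-1)%g) ->
  forall h, H h -> chi h = 1.
Proof.
have [chi_gt0 chiM chi_cont] := chi_mult => cH H1 HM HV.
have [m /[!inE] Hm maxm] : exists2 m, m \in H &
    forall h, h \in H -> chi h <= chi m.
  apply: compact_EVT_max => //; first by exists 1%g.
  exact: continuous_subspaceT.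
have chi_le1 h : H h -> chi h <= 1.
  move=> Hh; have := maxm (m * h)%g; rewrite inE chiM => /(_ (HM _ _ Hm Hh)).
  by rewrite -ler_pdivlMl// mulVf// gt_eqF.
move=> h Hh; apply/eqP; rewrite eq_le chi_le1//=.
by have := chi_le1 _ (HV _ Hh); rewrite multiplierV invf_le1.
Qed.

Lemma continuous_coset_multiplier (H : set G) : H 1%g ->
  (forall g h, H g -> H h -> H (g * h)%g) -> (forall g, H g -> H (g^-1)%g) ->
  (forall h, H h -> chi h = 1) ->
  continuous (coset_multiplier chi : left_cosets H -> R).
Proof.
have [chi_gt0 chiM chi_cont] := chi_mult => H1 HM HV chi1.
apply/quotient_continuous.
have -> // : coset_multiplier chi \o \pi_(left_cosets H)%qT = chi.
by apply/funext => g; exact: coset_multiplierE.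
Qed.

End Multiplier.

Lemma continuous_measurable_borel_real (R : realType) (T : ptopologicalType)
    (f : T -> R) : continuous f -> measurable_fun setT (f : borel T -> R).
Proof.
move=> /continuousP cf; apply: (measurability _ (RGenOpens.measurableE R)).
move=> _ [_ [a [b ->]] <-]; rewrite setTI; apply: measurable_open; apply: cf.
exact: interval_open.
Qed.

(** * Orbital decompositions *)

Section Isotropy.
Variables (G : groupType) (X : Type) (a : left_action G X) (x : X).

Lemma isotropy1 : isotropy a x 1%g.
Proof. exact: act1. Qed.

Lemma isotropyM g h :
  isotropy a x g -> isotropy a x h -> isotropy a x (g * h)%g.
Proof. by rewrite /isotropy /= actM => gx ->. Qed.

Lemma isotropyV g : isotropy a x g -> isotropy a x g^-1%g.
Proof.
by rewrite /isotropy /= => gx; rewrite -{1}gx -actM mulVg act1.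
Qed.

Lemma act_eq g h : a g x = a h x -> isotropy a x (g^-1 * h)%g.
Proof. by rewrite /isotropy /= actM => <-; rewrite -actM mulVg act1. Qed.

End Isotropy.

Section OrbitalDecompositionTheory.
Variables (G : topologicalGroupType) (X : ptopologicalType).
Variables (a : left_action G X) (G0 : set G) (Z : global_cross_section a).
Hypothesis Z_isotropy : forall z, gcs_set Z z -> isotropy a z = G0.

Lemma gcs_valP (u : gcs_space Z) : gcs_set Z (gcs_val u).
Proof. exact: set_mem (valP u). Qed.

Lemma gcs_isotropyE (u : gcs_space Z) : isotropy a (gcs_val u) = G0.
Proof. by apply: Z_isotropy; exact: gcs_valP. Qed.

Lemma gcs_subgroup : [/\ G0 1%g, (forall g h, G0 g -> G0 h -> G0 (g * h)%g)
  & (forall g, G0 g -> G0 g^-1%g)].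
Proof.
rewrite -(gcs_isotropyE point); split; first exact: isotropy1.
  exact: isotropyM.
exact: isotropyV.
Qed.

Variables (y : X -> left_cosets G0) (z : X -> gcs_space Z).
Hypothesis yz_dec : orbital_decomposition y z.

Lemma gcs_val_act_inj g h (u v : gcs_space Z) :
  a g (gcs_val u) = a h (gcs_val v) -> u = v.
Proof.
move=> guhv; have [w Zw] := gcs_cross_section Z (a h (gcs_val v)).
have inw (t : gcs_space Z) k :
    a k (gcs_val t) = a h (gcs_val v) -> gcs_val t = w.
  move=> kt; suff : [set w] (gcs_val t) by [].
  rewrite -Zw; split; first exact: gcs_valP.
  by exists k^-1%g => //; rewrite -kt -actM mulVg act1.
by apply: val_inj; rewrite [LHS](inw u g)// [RHS](inw v h).
Qed.

(** Uniqueness of the coordinates: [Z] meets the orbit only once, which fixes [u], and two group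
    elements carrying [u] to the same point differ by an element of its isotropy group [G0]. *)
Lemma orbital_decomposition_act g (u : gcs_space Z) :
  y (a g (gcs_val u)) = coset_proj G0 g /\ z (a g (gcs_val u)) = u.
Proof.
have [h e ->] := yz_dec (a g (gcs_val u)).
have zu := gcs_val_act_inj e; rewrite -zu in e *; split=> //.
have [H1 HM HV] := gcs_subgroup; apply/(coset_proj_eq H1 HM HV).
by rewrite -(gcs_isotropyE u); exact: act_eq.
Qed.

Lemma orbital_decomposition_selection (s : left_cosets G0 -> G) x :
  selection s -> x = a (s (y x)) (gcs_val (z x)).
Proof.
move=> s_sel; have [g e yg] := yz_dec x.
have [H1 HM HV] := gcs_subgroup.
have /(coset_proj_eq H1 HM HV) : coset_proj G0 (s (y x)) = coset_proj G0 g.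
  by rewrite s_sel.
rewrite -(gcs_isotropyE (z x)) => sg.
by rewrite {1}e -{2}sg -actM mulVKg.
Qed.

End OrbitalDecompositionTheory.

(** Transported by [phi], [m] has density [p] with respect to the product measure; Tonelli then
    applies, with the [T2] integral outside so that the inner integral runs over one slice. *)
Lemma ge0_integral_product_density d d1 d2 (T : measurableType d)
    (T1 : measurableType d1) (T2 : measurableType d2) (R : realType)
    (m : {measure set T -> \bar R})
    (m1 : {sigma_finite_measure set T1 -> \bar R})
    (m2 : {sigma_finite_measure set T2 -> \bar R})
    (phi : T -> T1 * T2) (h : T1 * T2 -> T) (p : T1 -> R) (F : T -> \bar R) :
  measurable_fun setT phi -> measurable_fun setT h ->
  cancel phi h -> cancel h phi ->
  measurable_fun setT p -> (forall t, 0 <= p t)%R ->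
  (forall B, measurable B ->
    m B = \int[(m1 \x m2)%E]_(q in phi @` B) (p q.1)%:E)%E ->
  measurable_fun setT F -> (forall t, 0 <= F t)%E ->
  (\int[m]_t F t = \int[m2]_v \int[m1]_u (F (h (u, v)) * (p u)%:E))%E.
Proof.
move=> mphi mh phiK hK mp p0 mE mF F0.
have mFh : measurable_fun setT (F \o h) by exact: measurableT_comp.
have mp1 : measurable_fun setT (fun q : T1 * T2 => p q.1).
  exact: (measurableT_comp mp).
transitivity (\int[pushforward m phi]_q (F \o h) q)%E.
  rewrite [RHS]ge0_integral_pushforward//; last by move=> q _; exact: F0.
  by apply: eq_integral => t _ /=; rewrite phiK.
rewrite (@ge0_integral_density _ _ _ (m1 \x m2)%E _ (fun q => p q.1)) //;
  last 2 first.
- move=> B mB; rewrite [LHS](mE (phi @^-1` B)); last first.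
    by rewrite -[X in measurable X]setTI; exact: mphi.
  congr (integral _ _ _); apply/seteqP; split=> [_ [t Bt <-]//|q Bq].
  by exists (h q); [rewrite /preimage /= hK | exact: hK].
- by move=> q; exact: F0.
rewrite fubini_tonelli2//.
  by apply: emeasurable_funM => //; exact/measurable_EFinP.
by move=> q; apply: mule_ge0; [exact: F0 | rewrite lee_fin].
Qed.

Section OrbitalIntegral.
Local Open Scope ereal_scope.
Variables (R : realType) (G : topologicalGroupType) (X : ptopologicalType).
Variables (a : left_action G X).
Hypotheses (hausG : hausdorff_space G) (scG : @second_countable G)
  (lcG : locally_compact [set: G]).
Variables (G0 : set G) (Z : global_cross_section a).
Hypotheses (cG0 : compact G0)
  (Z_isotropy : forall z, gcs_set Z z -> isotropy a z = G0).
Variables (y : X -> left_cosets G0) (z : X -> gcs_space Z).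
Hypotheses (yz_dec : orbital_decomposition y z)
  (yz_meas : bimeasurable_decomposition y z).

Lemma measurable_orbital_decomposition :
  measurable_fun setT (y : borel X -> borel (left_cosets G0)) /\
  measurable_fun setT (z : borel X -> borel (gcs_space Z)).
Proof.
have [myz _] := yz_meas; split.
- apply: (@measurableT_comp _ _ _ _ _ _
    (fst : borel (left_cosets G0 * gcs_space Z)%type -> borel (left_cosets G0))
    _ _ _ myz).
  by apply: continuous_measurable_borel => p; exact: cvg_fst.
- apply: (@measurableT_comp _ _ _ _ _ _
    (snd : borel (left_cosets G0 * gcs_space Z)%type -> borel (gcs_space Z))
    _ _ _ myz).
  by apply: continuous_measurable_borel => p; exact: cvg_snd.
Qed.

(** Identifies the measurable inverse provided by bimeasurability with the action itself, so that (g
    G0, u) -> g u is measurable without choosing representatives. *)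
Lemma orbital_recomposition :
  exists2 h : borel (left_cosets G0) * borel (gcs_space Z) -> borel X,
    measurable_fun setT h &
    cancel (fun x => (y x, z x)) h /\
    forall g u, h (coset_proj G0 g, u) = a g (gcs_val u).
Proof.
have [_ [h [yzK hK mh]]] := yz_meas; exists h.
  have [H1 HM HV] := gcs_subgroup Z_isotropy.
  have scY := second_countable_cosets H1 HM HV scG.
  exact: (@measurableT_comp _ _ _ _ _ _ h _ _ mh
    (@measurable_prod_borel (left_cosets G0) (gcs_space Z) scY)).
split=> // g u.
have [<- {2}<-] := orbital_decomposition_act Z_isotropy yz_dec g u.
by rewrite yzK.
Qed.

Variables (chi : G -> R) (lambda : {measure set (borel X) -> \bar R}).
Variables (mu : {measure set (borel G) -> \bar R}).
Variable (nu : probability (borel (gcs_space Z)) R).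
Hypotheses (chi_mult : multiplier chi) (mu_haar : left_haar_measure mu)
  (lambda_fact : factors lambda chi mu nu y z).

(** Since the measure on cosets is the image of [mu] and [chi] is trivial on [G0], the integral over
    cosets lifts to [G], where right translations are available. *)
Lemma ge0_integral_factors (F : borel X -> \bar R) :
  measurable_fun setT F -> (forall x, 0 <= F x) ->
  \int[lambda]_x F x =
  \int[nu]_u \int[mu]_g (F (a g (gcs_val u)) * (chi g)%:E).
Proof.
move=> mF F0; have [G01 G0M G0V] := gcs_subgroup Z_isotropy.
have [chi_gt0 chiM chi_cont] := chi_mult.
have chi1 := multiplier_compact_subgroup chi_mult cG0 G01 G0M G0V.
have [my mz] := measurable_orbital_decomposition.
have [h mh [yzK hE]] := orbital_recomposition.
pose phi x : borel (left_cosets G0) * borel (gcs_space Z) := (y x, z x).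
have mphi : measurable_fun setT (phi : borel X -> _).
  exact: measurable_fun_pair.
have hK : cancel h phi.
  move=> [c u]; have [g <-] := coset_proj_surj c.
  rewrite hE /phi.
  by have [-> ->] := orbital_decomposition_act Z_isotropy yz_dec g u.
have mpi : measurable_fun setT
    (coset_proj G0 : borel G -> borel (left_cosets G0)).
  by apply: continuous_measurable_borel; exact: coset_proj_continuous.
(* [coset_measure mu] is a bare set function; Tonelli needs it packaged as a sigma-finite
   measure. *)
have [muY muYE] : exists muY : {sigma_finite_measure set
    (borel (left_cosets G0)) -> \bar R}, coset_measure mu = muY.
  have sf := coset_measure_sigma_finite hausG scG lcG mu_haar cG0 G01 G0M G0V.
  rewrite /coset_measure in sf *; unshelve eexists.
    by unshelve refine (sigma_finite_measure_of (m := pushforward mu _) sf).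
  by [].
have mchi : measurable_fun setT
    (coset_multiplier chi : borel (left_cosets G0) -> R).
  apply: continuous_measurable_borel_real.
  exact: continuous_coset_multiplier chi1.
have chiE := coset_multiplierE G01 G0M G0V chiM chi1.
rewrite (ge0_integral_product_density (m1 := muY) (m2 := nu) (h := h)
  mphi mh yzK hK mchi)//; last 2 first.
- by move=> c; exact/ltW/chi_gt0.
- by move=> B mB; rewrite lambda_fact// muYE.
apply: eq_integral => u _.
rewrite -muYE /coset_measure ge0_integral_pushforward//; last 2 first.
- apply: emeasurable_funM; last exact/measurable_EFinP.
  exact: (measurableT_comp mF (measurableT_comp mh _)).
- by move=> c _; apply: mule_ge0; [exact: F0 | exact/ltW/chi_gt0].
by apply: eq_integral => g _ /=; rewrite hE chiE.
Qed.

End OrbitalIntegral.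

(** * The within-orbit bijection *)

Section WithinOrbitMap.
Variables (G : topologicalGroupType) (X : ptopologicalType).
Variables (a : left_action G X) (G0 : set G) (Z Z' : global_cross_section a).
Hypotheses (Z_isotropy : forall z, gcs_set Z z -> isotropy a z = G0)
  (Z'_isotropy : forall z', gcs_set Z' z' -> isotropy a z' = G0).
Variables (y : X -> left_cosets G0) (z : X -> gcs_space Z).
Variables (y' : X -> left_cosets G0) (z' : X -> gcs_space Z').
Hypotheses (yz_dec : orbital_decomposition y z)
  (yz'_dec : orbital_decomposition y' z').
Variables (s s' : left_cosets G0 -> G).
Hypotheses (s_sel : selection s) (s'_sel : selection s').

Local Notation w := (within_orbit (s \o y) z').
Local Notation n u := (s' (y' (gcs_val u))).

Lemma orbital_decomposition_act_other g (u : gcs_space Z) :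
  y' (a g (gcs_val u)) = coset_proj G0 (g * n u)%g /\
  z' (a g (gcs_val u)) = z' (gcs_val u).
Proof.
rewrite {1 3}(orbital_decomposition_selection Z'_isotropy yz'_dec
  (gcs_val u) s'_sel).
by rewrite -actM; exact: orbital_decomposition_act.
Qed.

Lemma within_orbit_act g (u : gcs_space Z) :
  w (a g (gcs_val u)) = a g (gcs_val (z' (gcs_val u))).
Proof.
rewrite /within_orbit /= (orbital_decomposition_act_other g u).2.
rewrite (orbital_decomposition_act Z_isotropy yz_dec g u).1.
have [H1 HM HV] := gcs_subgroup Z_isotropy.
have /(coset_proj_eq H1 HM HV) : coset_proj G0 g =
    coset_proj G0 (s (coset_proj G0 g)) by rewrite s_sel.
(* The selected representative differs from [g] by an element of [G0], which fixes the points of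
   [Z']: hence the independence of the selection. *)
move=> gs; have {}gs : isotropy a (gcs_val (z' (gcs_val u)))
    (g^-1 * s (coset_proj G0 g))%g by rewrite (gcs_isotropyE Z'_isotropy).
by rewrite -[in RHS]gs -actM mulVKg.
Qed.

Lemma within_orbit_actV g (u : gcs_space Z) :
  w (a g (gcs_val u)) = a (g * (n u)^-1)%g (gcs_val u).
Proof.
rewrite within_orbit_act actM; congr (a g _).
rewrite [X in _ = a _ X](orbital_decomposition_selection Z'_isotropy yz'_dec
  (gcs_val u) s'_sel).
by rewrite -actM mulVg act1.
Qed.

Lemma coset_within_orbit x : y' (w x) = y x.
Proof.
have [g -> _] := yz_dec x; rewrite within_orbit_act.
rewrite (orbital_decomposition_act Z'_isotropy yz'_dec _ _).1.
by rewrite (orbital_decomposition_act Z_isotropy yz_dec _ _).1.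
Qed.

End WithinOrbitMap.

Theorem theorem3p2
  (R : realType) (G : topologicalGroupType) (X : ptopologicalType)
  (a : left_action G X)
  (hausX : hausdorff_space X) (lcX : locally_compact [set: X])
  (scG : @second_countable G)
  (hausG : hausdorff_space G) (lcG : locally_compact [set: G])
  (a_cont : continuous (fun p : G * X => a p.1 p.2))
  (G0 : set G) (G0_compact : compact G0)
  (Z Z' : global_cross_section a)
  (Z_isotropy : forall z, gcs_set Z z -> isotropy a z = G0)
  (Z'_isotropy : forall z', gcs_set Z' z' -> isotropy a z' = G0)
  (lcZ : locally_compact [set: gcs_space Z])
  (lcZ' : locally_compact [set: gcs_space Z'])
  (y : X -> left_cosets G0) (z : X -> gcs_space Z)
  (yz_dec : orbital_decomposition y z)
  (yz_meas : bimeasurable_decomposition y z)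
  (y' : X -> left_cosets G0) (z' : X -> gcs_space Z')
  (yz'_dec : orbital_decomposition y' z')
  (yz'_meas : bimeasurable_decomposition y' z')
  (s s' : left_cosets G0 -> G) (s_sel : selection s) (s'_sel : selection s')
  (chi : G -> R) (chi_mult : multiplier chi)
  (lambda : {measure set (borel X) -> \bar R})
  (lambda_inv : relatively_invariant a lambda chi)
  (mu : {measure set (borel G) -> \bar R}) (mu_haar : left_haar_measure mu)
  (Delta : G -> R) (Delta_mod : right_modulus mu Delta)
  (nu : probability (borel (gcs_space Z)) R)
  (lambda_fact : factors lambda chi mu nu y z)
  (f : left_cosets G0 -> R)
  (d : measure_display) (Omega : measurableType d) (P : probability Omega R)
  (x : {RV P >-> borel X})
  (x_dist : cross_sectionally_contoured lambda f y (distribution P x)) :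
  let g := s \o y in
  let g' := s' \o y' in
  let w := within_orbit g z' in
  measurable_fun [set: Omega] ((w \o x) : Omega -> borel X) /\
  has_density lambda (pushforward P ((w \o x) : Omega -> borel X))
    (fun u => f (y' u) * chi ((g u)^-1 * g' u)%g
                       * Delta ((g u)^-1 * g' u)%g).
Proof.
move=> g g' w.
have [G01 G0M G0V] := gcs_subgroup Z_isotropy.
have [chi_gt0 chiM chi_cont] := chi_mult.
have chi1 := multiplier_compact_subgroup chi_mult G0_compact G01 G0M G0V.
have Delta_gt0 := modulus_gt0 hausG mu_haar Delta_mod.
have DeltaM := modulusM hausG mu_haar Delta_mod.
have Delta1 := modulus_compact_subgroup hausG mu_haar Delta_mod
  G0_compact G01 G0M G0V.
have neq0 (D : G -> R) : (forall g, 0 < D g) -> forall g, D g != 0.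
  by move=> D0 k; rewrite gt_eqF.
have ratio_chi := coset_multiplier_ratio G01 G0M G0V chiM chi1
  (neq0 _ chi_gt0) s_sel s'_sel.
have ratio_Delta := coset_multiplier_ratio G01 G0M G0V DeltaM Delta1
  (neq0 _ Delta_gt0) s_sel s'_sel.
have mchi : measurable_fun setT
    (coset_multiplier chi : borel (left_cosets G0) -> R).
  apply: continuous_measurable_borel_real.
  exact: continuous_coset_multiplier chi1.
have mDelta := measurable_coset_modulus hausG scG lcG mu_haar Delta_mod
  G0_compact G01 G0M G0V.
have [my mz] := measurable_orbital_decomposition yz_meas.
have [my' mz'] := measurable_orbital_decomposition yz'_meas.
have [h mh [_ hE]] :=
  orbital_recomposition scG Z_isotropy yz_dec yz_meas.
have [h' mh' [_ hE']] :=
  orbital_recomposition scG Z'_isotropy yz'_dec yz'_meas.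
have y_act k u := (orbital_decomposition_act Z_isotropy yz_dec k u).1.
have mw : measurable_fun setT (w : borel X -> borel X).
  (* w(t) is the point with coset y(t) and cross-section point z'(t) in the coordinates of [Z'], a
     description free of [s]. *)
  have -> : w = (fun t => h' (y t, z' t)).
    apply/funext => t; have [k -> _] := yz_dec t.
    rewrite /w.
    rewrite (within_orbit_act Z_isotropy Z'_isotropy yz_dec yz'_dec s_sel
      s'_sel).
    rewrite y_act.
    rewrite (orbital_decomposition_act_other Z'_isotropy yz'_dec s'_sel _ _).2.
    by rewrite hE'.
  apply: (measurableT_comp mh').
  exact: measurable_fun_pair.
have [mfy fy0 x_density] := x_dist.
(* Only [f \o y] is given as measurable and nonnegative; restricting to the slice over the base
   point of [Z] transfers both properties to [f]. *)
have fE c : f c = f (y (h (c, point))).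
  by have [k <-] := coset_proj_surj c; rewrite hE y_act.
have f0 c : 0 <= f c by rewrite fE; exact: fy0.
have mf : measurable_fun setT (f : borel (left_cosets G0) -> R).
  have -> : f = (f \o y) \o (h \o (fun c => (c, point))).
    by apply/funext => c; rewrite fE.
  apply: (measurableT_comp mfy).
  apply: (measurableT_comp mh).
  exact: measurable_fun_pair.
pose r u : R := chi ((g u)^-1 * g' u)%g * Delta ((g u)^-1 * g' u)%g.
have r0 u : 0 <= r u by rewrite mulr_ge0// ltW.
have mr : measurable_fun setT (r : borel X -> R).
  have -> : r = (fun u =>
      (coset_multiplier chi (y u))^-1 * coset_multiplier chi (y' u) *
      ((coset_multiplier Delta (y u))^-1 * coset_multiplier Delta (y' u))).
    by apply/funext => u; rewrite /r ratio_chi ratio_Delta.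
  have mV D : (forall c : left_cosets G0, 0 <= D c) ->
      measurable_fun setT (D : borel (left_cosets G0) -> R) ->
      measurable_fun setT ((fun u => (D (y u))^-1 * D (y' u)) : borel X -> R).
    move=> D0 mD; apply: measurable_funM; last exact: (measurableT_comp mD).
    apply: measurable_funV => [t|]; first exact: D0.
    exact: (measurableT_comp mD).
  apply: measurable_funM; apply: mV => // c; apply/ltW.
    exact: chi_gt0.
  exact: Delta_gt0.
have mfy' : measurable_fun setT ((f \o y') : borel X -> R).
  exact: (measurableT_comp mf my').
split; first exact: (measurableT_comp mw).
split.
- have -> : (fun u => f (y' u) * chi ((g u)^-1 * g' u)%g *
      Delta ((g u)^-1 * g' u)%g) = (fun u => f (y' u) * r u).
    by apply/funext => u; rewrite mulrA.
  exact: measurable_funM.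
- by move=> u; rewrite -mulrA mulr_ge0// r0.
move=> B mB.
(* Chosen so that [F \o w] is [f \o y] cut to the preimage of [B], whose integral is the probability
   that w(x) lies in [B]. What remains is the change of variables from [F \o w] to [F] times [r]. *)
pose F := ((EFin \o (f \o y')) \_ B)%E : borel X -> \bar R.
have mF : measurable_fun setT F.
  apply/(measurable_restrictT _ _).1 => //.
  exact/measurable_funTS/measurable_EFinP.
have F0 t : (0 <= F t)%E by apply: erestrict_ge0 => u _; exact: f0.
transitivity (\int[lambda]_t F (w t))%E.
  have mwB : measurable (w @^-1` B : set (borel X)).
    by rewrite -[X in measurable X]setTI; exact: mw.
  rewrite [LHS](x_density _ mwB) integral_mkcond.
  apply: eq_integral => t _; rewrite /F /patch /=.
  have -> : (t \in w @^-1` B) = (w t \in B) by apply/idP/idP; rewrite !inE.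
  by rewrite (coset_within_orbit Z_isotropy Z'_isotropy yz_dec yz'_dec s_sel
    s'_sel).
transitivity (\int[lambda]_t (F t * (r t)%:E))%E; last first.
  rewrite [RHS]integral_mkcond; apply: eq_integral => t _.
  rewrite /F /patch; case: ifP => _; last by rewrite mul0e.
  by rewrite -EFinM /= mulrA.
rewrite (ge0_integral_factors hausG scG lcG G0_compact Z_isotropy yz_dec yz_meas
  chi_mult mu_haar lambda_fact)//; last exact: (measurableT_comp mF mw).
rewrite (ge0_integral_factors hausG scG lcG G0_compact Z_isotropy yz_dec yz_meas
  chi_mult mu_haar lambda_fact)//; last 2 first.
- by apply: emeasurable_funM => //; exact/measurable_EFinP.
- by move=> t; rewrite mule_ge0// lee_fin.
apply: eq_integral => u _.
pose n := s' (y' (gcs_val u)).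
pose K (k : borel G) : \bar R := (F (a k (gcs_val u)) * (chi k)%:E)%E.
have K0 k : (0 <= K k)%E by rewrite mule_ge0// lee_fin ltW.
have mK : measurable_fun setT K.
  apply: emeasurable_funM; last first.
    by apply/measurable_EFinP; exact: continuous_measurable_borel_real.
  have -> : (fun k => F (a k (gcs_val u))) =
      F \o (h \o (fun k => (coset_proj G0 k, u))).
    by apply/funext => k /=; rewrite hE.
  apply: (measurableT_comp mF); apply: (measurableT_comp mh).
  apply: measurable_fun_pair => //.
  by apply: continuous_measurable_borel; exact: coset_proj_continuous.
(* The two cosets are those of k and k n, so k cancels and [r] is constant on the slice. *)
have rE k : r (a k (gcs_val u)) = chi n * Delta n.
  rewrite /r /g /g' /=.
  rewrite y_act.
  rewrite (orbital_decomposition_act_other Z'_isotropy yz'_dec s'_sel _ _).1.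
  rewrite ratio_chi ratio_Delta.
  rewrite !(coset_multiplierE G01 G0M G0V chiM chi1).
  rewrite !(coset_multiplierE G01 G0M G0V DeltaM Delta1) chiM DeltaM.
  by rewrite (mulKf (neq0 _ chi_gt0 k)) (mulKf (neq0 _ Delta_gt0 k)).
(* Splitting chi k = chi (k n^-1) * chi n makes the integrand a right translate of [K]; translating
   back then produces Delta n. *)
transitivity (\int[mu]_k ((chi n)%:E * K (k * n^-1)%g))%E.
  apply: eq_integral => k _; rewrite /K /w.
  rewrite (within_orbit_actV Z_isotropy Z'_isotropy yz_dec yz'_dec s_sel
    s'_sel).
  by rewrite muleCA -EFinM mulrC -chiM mulgVK.
transitivity (\int[mu]_k ((chi n * Delta n)%:E * K k))%E; last first.
  by apply: eq_integral => k _; rewrite rE /K muleAC muleC.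
rewrite ge0_integralZl_EFin//; last 2 first.
- apply: (measurableT_comp mK).
  exact: continuous_measurable_borel (@mulgr_continuous G n^-1%g).
- exact: ltW.
rewrite (ge0_integral_mulgr hausG mu_haar Delta_mod)//.
by rewrite muleA -EFinM ge0_integralZl_EFin// mulr_ge0// ltW.
Qed.
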